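(* Let $\delta t=t_{n+1}-t_n$. Assume that: (A1) there exist positive constants $\gamma_\alpha$ such that $f_\alpha(S_\alpha)\le\gamma_\alpha S_\alpha$, $\alpha=w,n$; (A2) if $F_\alpha$ is a sink term, i.e. $F_\alpha\le0$, then there exist positive constants $\beta_1,\beta_2$ such that $\beta_1S_\alpha\le|F_\alpha|\le\beta_2S_\alpha$. For the approximate saturations of the P-IMPES scheme (defined in the context), assume that $S^{h,n}_\alpha\in(0,1)$ with tolerance saturation $S_{t\alpha}>0$, namely $S^{h,n}_\alpha\ge S_{t\alpha}$, $\alpha=w,n$. Then for any $K\in\mathcal{T}_h$, if $\frac{\delta t}{h}$ is sufficiently small, the saturations at time step $n+1$ satisfy on $K$ $$S^{h,n+1}_\alpha\in(0,1),\qquad\alpha=w,n.$$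
   Context: **Model.** Incompressible immiscible two-phase flow (wetting phase $w$, non-wetting phase $n$) in $\Omega\subset\mathbb{R}^d$, $d=2,3$: for $\alpha=w,n$, $\phi\,\partial_t S_\alpha+\nabla\cdot\mathbf{u}_\alpha=F_\alpha$, $\mathbf{u}_\alpha=-\lambda_\alpha\mathbf{K}(\nabla p_\alpha+\rho_\alpha g\nabla z)$, $S_n+S_w=1$, $p_c(S_w)=p_n-p_w$. Here $\phi$ is the porosity (time-independent, uniformly bounded below and above), $\mathbf{K}$ is the symmetric positive definite absolute permeability tensor, $\rho_\alpha$ the densities, $g$ the gravitational acceleration, $z$ the depth, $F_\alpha$ the source/sink terms, $F_t=F_w+F_n$, $p_c$ the capillary pressure function, and $\lambda_\alpha=\lambda_\alpha(S_w)$ the phase mobilities. $\lambda_t=\lambda_w+\lambda_n$ and $f_\alpha=\lambda_\alpha/\lambda_t$, so $f_w+f_n=1$. The $f_\alpha$ are functions of $S_w$; writing $f_n(S_n)$ in (A1) means $f_n$ viewed as a function of $S_n=1-S_w$. There are positive constants with $0\le\lambda_\alpha(S_w)\le\overline{\lambda}_\alpha$, $0<\lambda_t(S_w)\le\overline{\lambda}_t$. The boundary is $\Gamma=\partial\Omega=\Gamma_D\cup\Gamma_N$ (disjoint), with $p_\alpha=p^B_\alpha$ on $\Gamma_D$, $\mathbf{u}_\alpha\cdot\mathbf{n}=g^N_\alpha$ on $\Gamma_N$, and $S_\alpha=S^B_\alpha$ on the inflow boundary $\Gamma_{\rm in}=\{\mathbf{x}\in\Gamma:\mathbf{u}_t\cdot\mathbf{n}<0\}$,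 $\mathbf{u}_t=\mathbf{u}_w+\mathbf{u}_n$. **Spaces.** $\mathcal{T}_h$ is a quasi-uniform (shape-regular) simplicial mesh of $\Omega$, $h_K$ is the diameter of $K\in\mathcal{T}_h$, $h=\min_{K\in\mathcal{T}_h}h_K$. $\mathbf{U}_h=RT_0(\mathcal{T}_h)$ is the lowest-order Raviart–Thomas space (on each $K$, $\mathbf{v}=\mathbf{a}+b\mathbf{x}$ with $\mathbf{a}\in\mathbb{R}^d$, $b\in\mathbb{R}$, and normal components continuous across interior edges/faces), $\mathbf{U}^0_h=\{\mathbf{v}\in\mathbf{U}_h:\mathbf{v}\cdot\mathbf{n}=0\text{ on }\Gamma_N\}$, and $Q_h$ is the space of piecewise constants on $\mathcal{T}_h$. $(\cdot,\cdot)$ is the $L^2(\Omega)$ inner product. **Upwind values.** Let $\mathbf{u}^{h,n}_\alpha$ be the discrete velocity of phase $\alpha$ available at time step $n$ (computed elementwise by $\mathbf{u}^h_w=f_w\mathbf{u}^h_t-f_wf_n\boldsymbol{\xi}^h_c$, $\mathbf{u}^h_n=f_n\mathbf{u}^h_t+f_wf_n\boldsymbol{\xi}^h_c$), and let $\{\cdot\}$ denote the average across an interior edge/face. On $\gamma=\partial K_i\cap\partial K_j$ with unit normal $\mathbf{n}_\gamma$ exterior to $K_i$, put $S^{\ast,h,n}_\alpha=S^{h,n}_\alpha|_{K_i}$ if $\{\mathbf{u}^{h,n}_\alpha\cdot\mathbf{n}_\gamma\}\ge0$ and $S^{\ast,h,n}_\alpha=S^{h,n}_\alpha|_{K_j}$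 otherwise; then $S^{\ast,h,n}_{w,w}=S^{\ast,h,n}_w$ and $S^{\ast,h,n}_{w,n}=1-S^{\ast,h,n}_n$. On $\gamma\subset\Gamma_{\rm in}$, $S^{\ast,h,n}_{w,\alpha}$ is the $L^2$-projection of $S^B_w$ onto constants on $\gamma$; on other boundary edges/faces it is the value $S^{h,n}_w$ of the adjacent element. **Forms.** For $\mathbf{v}\in\mathbf{U}_h$, $q\in Q_h$: $$B_\alpha(\mathbf{v},q;S^{h,n}_w)=\sum_{K\in\mathcal{T}_h}\int_{\partial K}f_\alpha(S^{\ast,h,n}_{w,\alpha})\,\mathbf{v}\cdot\mathbf{n}\,q,\qquad B_c(\mathbf{v},q;S^{h,n}_w)=\sum_{K\in\mathcal{T}_h}\int_{\partial K}f_n(S^{\ast,h,n}_{w,n})f_w(S^{\ast,h,n}_{w,w})\,\mathbf{v}\cdot\mathbf{n}\,q,$$ with $\mathbf{n}$ the unit outward normal to $\partial K$ and $q$ on $\partial K$ taken from inside $K$. **P-IMPES scheme.** Given $S^{h,n}_w$ and $S^{h,n}_n=1-S^{h,n}_w$, find $\mathbf{u}^{h,n+1}_t,\boldsymbol{\xi}^{h,n+1}_c\in\mathbf{U}_h$, $p^{h,n+1}_\alpha,S^{h,n+1}_\alpha\in Q_h$ ($\alpha=w,n$) such that for all $\mathbf{v}\in\mathbf{U}^0_h$, $q\in Q_h$ (with $\lambda_t,f_w,f_n$ evaluated at $S^{h,n}_w$ in the second and third equations): 1. $\big(\phi\frac{S^{h,n+1}_\alpha-S^{h,n}_\alpha}{t_{n+1}-t_n},q\big)+B_\alpha(\mathbf{u}^{h,n+1}_t,q;S^{h,n}_w)=(F_\alpha,q)+\sigma_\alpha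 B_c(\boldsymbol{\xi}^{h,n+1}_c,q;S^{h,n}_w)$, $\alpha=w,n$, with $\sigma_w=1,\sigma_n=-1$; 2. $((\lambda_t\mathbf{K})^{-1}\mathbf{u}^{h,n+1}_t,\mathbf{v})-(p^{h,n+1}_w,\nabla\cdot\mathbf{v})=((\lambda_t\mathbf{K})^{-1}f_n\boldsymbol{\xi}^{h,n+1}_c,\mathbf{v})-\int_{\Gamma_D}p^B_w\mathbf{v}\cdot\mathbf{n}-(\rho_wg\nabla z,\mathbf{v})$; 3. $((\lambda_t\mathbf{K})^{-1}\mathbf{u}^{h,n+1}_t,\mathbf{v})-(p^{h,n+1}_n,\nabla\cdot\mathbf{v})=-((\lambda_t\mathbf{K})^{-1}f_w\boldsymbol{\xi}^{h,n+1}_c,\mathbf{v})-\int_{\Gamma_D}p^B_n\mathbf{v}\cdot\mathbf{n}-(\rho_ng\nabla z,\mathbf{v})$; 4. $(S^{h,n+1}_n+S^{h,n+1}_w,q)=(1,q)$; 5. $(p^{h,n+1}_n-p^{h,n+1}_w,q)=(p_c(S^{h,n}_w),q)$. *)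

(* Defs.v *)
From HB Require Import structures.
From mathcomp Require Import all_boot all_order all_algebra.
From mathcomp Require Import all_classical all_reals all_analysis.

Set Implicit Arguments.
Unset Strict Implicit.
Unset Printing Implicit Defensive.

Import Order.TTheory GRing.Theory Num.Theory.
Import numFieldNormedType.Exports.

Local Open Scope classical_set_scope.
Local Open Scope ring_scope.

Section lebesgue_step.
Context (R : realType) (n : nat).
Local Notation mR := (measurableTypeR R).
Variable m : {sigma_finite_measure set (n.-tuple mR) -> \bar R}.

Definition cons_pair (p : mR * n.-tuple mR) : n.+1.-tuple mR :=
  [tuple of p.1 :: p.2].

Lemma measurable_cons_pair : measurable_fun [set: mR * n.-tuple mR] cons_pair.
Proof. exact: measurable_cons. Qed.

Definition lebesgue_step : set (n.+1.-tuple mR) -> \bar R :=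
  pushforward (lebesgue_measure \x m)%E cons_pair.

HB.instance Definition _ := Measure.copy lebesgue_step
  (measure_function_pushforward__canonical__measure_function_Measure
     (lebesgue_measure \x m)%E measurable_cons_pair).

Lemma sigma_finite_lebesgue_step : sigma_finite setT lebesgue_step.
Proof.
have /sigma_finiteP[F [TF ndF Foo]] :
  sigma_finite [set: mR] (@lebesgue_measure R) by exact: sigma_finiteT.
have /sigma_finiteP[G [TG ndG Goo]] := sigma_finiteT m.
pose uncons (t : n.+1.-tuple mR) : mR * n.-tuple mR :=
  (tnth t ord0, [tuple of behead t]).
have m_uncons : measurable_fun setT uncons.
  apply: measurable_fun_pair; first exact: measurable_tnth.
  exact: measurable_behead.
have consK : cancel cons_pair uncons.
  by case=> x t; rewrite /uncons /cons_pair/=; congr pair; exact/val_inj.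
exists (fun k => uncons @^-1` (F k `*` G k)).
  apply/esym/seteqP; split=> // t _.
  have [i _ Fi] : (\bigcup_i F i) (uncons t).1 by rewrite -TF.
  have [j _ Gj] : (\bigcup_i G i) (uncons t).2 by rewrite -TG.
  exists (maxn i j) => //; split.
    by move: Fi; exact/subsetPset/ndF/leq_maxl.
  by move: Gj; exact/subsetPset/ndG/leq_maxr.
move=> k; have [mF Fk] := Foo k; have [mG Gk] := Goo k; split.
  rewrite -[X in measurable X]setTI; apply: m_uncons => //.
  exact: measurableX.
rewrite /lebesgue_step /pushforward.
rewrite (_ : _ @^-1` _ = F k `*` G k); last first.
  rewrite -comp_preimage (_ : uncons \o cons_pair = id) ?preimage_id//.
  exact/funext/consK.
by rewrite product_measure1E// lte_mul_pinfty// ge0_fin_numE.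
Qed.

HB.instance Definition _ := Measure_isSigmaFinite.Build _ _ _ lebesgue_step
  sigma_finite_lebesgue_step.

End lebesgue_step.

(* Lebesgue measure on R^n, with R^(n+1) identified with R * R^n. *)
Fixpoint lebesgue_tuple (R : realType) (n : nat) :
    {sigma_finite_measure set (n.-tuple (measurableTypeR R)) -> \bar R} :=
  match n with
  | 0 => dirac ([tuple] : 0.-tuple (measurableTypeR R))
  | n'.+1 => lebesgue_step (lebesgue_tuple R n')
  end.

Section euclidean.
Context (R : realType).

Definition row_of_tuple d (t : d.-tuple (measurableTypeR R)) : 'rV[R]_d :=
  \row_i tnth t i.

Definition measurable_on d (E : set 'rV[R]_d) (f : 'rV[R]_d -> R) :=
  measurable_fun (@row_of_tuple d @^-1` E) (f \o @row_of_tuple d).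

Definition L2_on d (E : set 'rV[R]_d) (f : 'rV[R]_d -> R) :=
  measurable_on E f /\
  (lebesgue_tuple R d).-integrable (@row_of_tuple d @^-1` E)
    (fun t => (f (row_of_tuple t) ^+ 2)%:E).

Definition vol_integral d (E : set 'rV[R]_d) (g : 'rV[R]_d -> R) : R :=
  \int[lebesgue_tuple R d]_(t in @row_of_tuple d @^-1` E) g (row_of_tuple t).

Definition dot d (x y : 'rV[R]_d) : R := (x *m y^T) 0 0.

(* The norm `|x| provided on 'rV[R]_d is the maximum norm. *)
Definition enorm d (x : 'rV[R]_d) : R := Num.sqrt (dot x x).

Definition mx_apply d (A : 'M[R]_d) (x : 'rV[R]_d) : 'rV[R]_d := (A *m x^T)^T.

Definition grad d (f : 'rV[R]_d -> R) (x : 'rV[R]_d) : 'rV[R]_d :=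
  \row_i derive1 (fun s : R => f (x + s *: delta_mx 0 i)) 0.

Definition divergence d (v : 'rV[R]_d -> 'rV[R]_d) (x : 'rV[R]_d) : R :=
  \sum_i derive1 (fun s : R => v (x + s *: delta_mx 0 i) 0 i) 0.

Definition convex_hull d m (a : 'I_m -> 'rV[R]_d) (A : {set 'I_m}) :
    set 'rV[R]_d :=
  [set x | exists w : 'I_m -> R,
    [/\ forall i, 0 <= w i, forall i, i \notin A -> w i = 0,
        \sum_i w i = 1 & x = \sum_i w i *: a i]].

Definition simplex d m (a : 'I_m -> 'rV[R]_d) : set 'rV[R]_d :=
  convex_hull a finset.setT.

Definition open_simplex d m (a : 'I_m -> 'rV[R]_d) : set 'rV[R]_d :=
  [set x | exists w : 'I_m -> R,
    [/\ forall i, 0 < w i, \sum_i w i = 1 & x = \sum_i w i *: a i]].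

Definition edge_mx d m (a : 'I_m.+1 -> 'rV[R]_d) : 'M[R]_(m, d) :=
  \matrix_(i, k) (a (lift ord0 i) - a ord0) 0 k.

Definition reference_simplex m : set 'rV[R]_m :=
  [set t | (forall i, 0 <= t 0 i) /\ \sum_i t 0 i <= 1].

(* Integral of g over the m-simplex with vertices a in R^d, with respect to
   m-dimensional surface measure: the affine parametrization of the simplex has
   the constant area element sqrt (det (E E^T)), E being the edge matrix. *)
Definition surf_integral d m (a : 'I_m.+1 -> 'rV[R]_d) (g : 'rV[R]_d -> R) : R :=
  Num.sqrt (\det (edge_mx a *m (edge_mx a)^T)) *
  vol_integral (@reference_simplex m) (fun t => g (a ord0 + t *m edge_mx a)).

Definition L2_projection_const d m (a : 'I_m.+1 -> 'rV[R]_d)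
    (g : 'rV[R]_d -> R) : R :=
  xget 0 [set c | forall q : R, surf_integral a (fun x => (g x - c) * q) = 0].

End euclidean.

Variant phase := wet | nonwet.

(* sat_B is the boundary saturation of the wetting phase, extended arbitrarily
   off the boundary; mobility and cap_pressure are functions of the wetting
   saturation. *)
Record two_phase (R : realType) (d : nat) := TwoPhase {
  porosity : 'rV[R]_d -> R;
  permeability : 'rV[R]_d -> 'M[R]_d;
  density : phase -> R;
  gravity : R;
  depth : 'rV[R]_d -> R;
  source : phase -> 'rV[R]_d -> R;
  mobility : phase -> R -> R;
  cap_pressure : R -> R;
  pressure_B : phase -> 'rV[R]_d -> R;
  sat_B : 'rV[R]_d -> R;
  Gamma_D : set 'rV[R]_d;
  Gamma_N : set 'rV[R]_d
}.

Section model.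
Context (R : realType) (d : nat) (P : two_phase R d).

Definition total_mobility (s : R) := mobility P wet s + mobility P nonwet s.

Definition frac (al : phase) (s : R) := mobility P al s / total_mobility s.

(* Fractional flow of a phase as a function of the saturation of that phase. *)
Definition frac_own (al : phase) (s : R) :=
  match al with wet => frac wet s | nonwet => frac nonwet (1 - s) end.

Definition boundary (Om : set 'rV[R]_d) := closure Om `\` Om.

Record admissible (Om : set 'rV[R]_d) (phi_lo phi_hi : R)
    (lam_hi : phase -> R) (lamt_hi : R) : Prop := Admissible {
  porosity_measurable : measurable_on Om (porosity P);
  porosity_bounds : forall x, Om x -> phi_lo <= porosity P x <= phi_hi;
  permeability_sym : forall x, Om x -> (permeability P x)^T = permeability P x;
  permeability_pos : forall x, Om x -> forall v, v != 0 ->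
    0 < dot v (mx_apply (permeability P x) v);
  source_L2 : forall al, L2_on Om (source P al);
  mobility_bounds : forall al s, 0 <= s <= 1 ->
    0 <= mobility P al s <= lam_hi al;
  total_mobility_bounds : forall s, 0 <= s <= 1 ->
    0 < total_mobility s <= lamt_hi;
  sat_B_measurable : measurable_on setT (sat_B P);
  sat_B_bounds : forall x, 0 <= sat_B P x <= 1;
  boundary_split : Gamma_D P `|` Gamma_N P = boundary Om;
  boundary_disjoint : Gamma_D P `&` Gamma_N P = set0
}.

End model.

(* Conforming simplicial mesh in R^d, d = n.+1.  For two elements sharing a
   face, [precedes K K'] says that K plays the role of K_i and K' that of K_j in
   the definition of the upwind values. *)
Record mesh (R : realType) (n : nat) := Mesh {
  elt : finType;
  vtx : elt -> 'I_n.+2 -> 'rV[R]_n.+1;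
  precedes : rel elt;
  vtx_nondegenerate : forall K, \det (edge_mx (vtx K)) != 0;
  elt_disjoint : forall K K', K != K' ->
    open_simplex (vtx K) `&` open_simplex (vtx K') = set0;
  elt_conforming : forall K K', K != K' ->
    simplex (vtx K) `&` simplex (vtx K') =
    convex_hull (vtx K) [set i | vtx K i \in codom (vtx K')]%SET;
  precedes_total : forall K K', K != K' -> precedes K K' = ~~ precedes K' K
}.

Section mesh_geometry.
Context (R : realType) (n : nat) (T : mesh R n).
Local Notation point := 'rV[R]_n.+1.
Implicit Types (K : elt T) (j : 'I_n.+2).

Definition mesh_of (Om : set point) :=
  Om = interior (\bigcup_(K in [set: elt T]) simplex (vtx K)).

Definition elt_diam K : R :=
  sup [set r | exists x y, [/\ simplex (vtx K) x, simplex (vtx K) y &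
                              r = enorm (x - y)]].

Definition mesh_size : R := inf (range elt_diam).

(* Radius of the largest ball contained in K. *)
Definition inradius K : R :=
  sup [set r | 0 <= r /\ exists c : point,
    [set x | enorm (x - c) <= r] `<=` simplex (vtx K)].

Definition quasi_uniform (kappa : R) := forall K,
  elt_diam K <= kappa * (2 * inradius K) /\ elt_diam K <= kappa * mesh_size.

(* Face number j of K is the one opposite to vertex j. *)
Definition face_vtx K j (i : 'I_n.+1) : point := vtx K (lift j i).

Definition face K j : set point := simplex (face_vtx K j).

Definition neighbour K j : option (elt T) :=
  [pick K' | (K' != K) && [forall i, face_vtx K j i \in codom (vtx K')]].

Definition outward_normal K j : point :=
  xget 0 [set nu | [/\ enorm nu = 1,
    forall i, dot (face_vtx K j i - face_vtx K j ord0) nu = 0 &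
    dot (vtx K j - face_vtx K j ord0) nu < 0]].

(* Elementwise vector fields: v K is the restriction of v to K. *)
Definition vfield := elt T -> point -> point.

Definition normal_comp (v : vfield) K j (x : point) : R :=
  dot (v K x) (outward_normal K j).

Definition RT0 (v : vfield) :=
  (forall K, exists (a : point) (b : R), forall x, v K x = a + b *: x) /\
  (forall K j K', neighbour K j = Some K' -> forall x, face K j x ->
     dot (v K x) (outward_normal K j) = dot (v K' x) (outward_normal K j)).

Definition RT0_zero (GN : set point) (v : vfield) :=
  RT0 v /\
  (forall K j, neighbour K j = None -> forall x, face K j x -> GN x ->
     normal_comp v K j x = 0).

Definition Linf_norm (v : vfield) : R :=
  sup [set r | exists K x, simplex (vtx K) x /\ r = enorm (v K x)].

Definition inner (f g : elt T -> point -> R) : R :=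
  \sum_(K : elt T) vol_integral (open_simplex (vtx K)) (fun x => f K x * g K x).

Definition vinner (v w : vfield) : R :=
  \sum_(K : elt T)
    vol_integral (open_simplex (vtx K)) (fun x => dot (v K x) (w K x)).

Definition boundary_integral (G : set point) (g : point -> R) (v : vfield) : R :=
  \sum_(K : elt T) \sum_(j | neighbour K j == None)
    surf_integral (face_vtx K j) ((fun x => g x * normal_comp v K j x) \_ G).

End mesh_geometry.

Section scheme.
Context (R : realType) (n : nat) (P : two_phase R n.+1) (T : mesh R n).
Local Notation point := 'rV[R]_n.+1.

Section upwind.
(* Saturations, total velocity and capillary field known at step n. *)
Variables (S : phase -> elt T -> R) (ut xi : vfield T).

Definition phase_sign (al : phase) : R :=
  match al with wet => 1 | nonwet => -1 end.

Definition phase_velocity (al : phase) : vfield T := fun K x =>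
  frac P al (S wet K) *: ut K x -
  (phase_sign al * (frac P wet (S wet K) * frac P nonwet (S wet K))) *: xi K x.

Definition face_average (v : vfield T) (K K' : elt T) (nu x : point) : R :=
  (dot (v K x) nu + dot (v K' x) nu) / 2.

(* K is K_i and K' is K_j on face number j of K_i. *)
Definition upwind_from (al : phase) (K K' : elt T) (F : set point) (nu : point)
    : R :=
  if `[< forall x, F x -> 0 <= face_average (phase_velocity al) K K' nu x >]
  then S al K else S al K'.

Definition upwind_interior (al : phase) (K : elt T) (j : 'I_n.+2) (K' : elt T)
    : R :=
  if precedes K K'
  then upwind_from al K K' (face K j) (outward_normal K j)
  else upwind_from al K' K (face K j) (- outward_normal K j).

Definition inflow (K : elt T) (j : 'I_n.+2) : Prop := forall x, face K j x ->
  dot (phase_velocity wet K x + phase_velocity nonwet K x)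
      (outward_normal K j) < 0.

(* S^*_{w,al} on face number j of K. *)
Definition face_sat_w (al : phase) (K : elt T) (j : 'I_n.+2) : R :=
  match neighbour K j with
  | Some K' => match al with
               | wet => upwind_interior wet K j K'
               | nonwet => 1 - upwind_interior nonwet K j K'
               end
  | None => if `[< inflow K j >]
            then L2_projection_const (face_vtx K j) (sat_B P)
            else S wet K
  end.

Definition B_phase (al : phase) (v : vfield T) (q : elt T -> R) : R :=
  \sum_(K : elt T) \sum_j surf_integral (face_vtx K j) (fun x =>
    frac P al (face_sat_w al K j) * normal_comp v K j x * q K).

Definition B_cap (v : vfield T) (q : elt T -> R) : R :=
  \sum_(K : elt T) \sum_j surf_integral (face_vtx K j) (fun x =>
    frac P nonwet (face_sat_w nonwet K j) * frac P wet (face_sat_w wet K j) *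
    normal_comp v K j x * q K).

End upwind.

(* ((lambda_t K)^{-1} u, v), with lambda_t evaluated at the saturation s. *)
Definition resistance (s : elt T -> R) (u v : vfield T) : R :=
  vinner (fun K x =>
    mx_apply (invmx (total_mobility P (s K) *: permeability P x)) (u K x)) v.

Definition darcy (s : elt T -> R) (al : phase) (ut xi : vfield T)
    (p : elt T -> R) (v : vfield T) : Prop :=
  let f_other K := match al with wet => frac P nonwet (s K)
                               | nonwet => frac P wet (s K) end in
  resistance s ut v - inner (fun K _ => p K) (fun K => divergence (v K)) =
  phase_sign al * resistance s (fun K x => f_other K *: xi K x) v
  - boundary_integral (Gamma_D P) (pressure_B P al) v
  - vinner (fun _ x => (density P al * gravity P) *: grad (depth P) x) v.

(* One step from the data (S0, ut0, xi0) at time t0 to time t1. *)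
Record pimpes_step (t0 t1 : R) (S0 : phase -> elt T -> R) (ut0 xi0 : vfield T)
    (S1 p1 : phase -> elt T -> R) (ut1 xi1 : vfield T) : Prop := PimpesStep {
  step_ut : RT0 ut1;
  step_xi : RT0 xi1;
  step_saturation : forall al (q : elt T -> R),
    inner (fun K x => porosity P x * ((S1 al K - S0 al K) / (t1 - t0)))
          (fun K _ => q K)
    + B_phase S0 ut0 xi0 al ut1 q
    = inner (fun _ x => source P al x) (fun K _ => q K)
      + phase_sign al * B_cap S0 ut0 xi0 xi1 q;
  step_darcy : forall al (v : vfield T), RT0_zero (Gamma_N P) v ->
    darcy (S0 wet) al ut1 xi1 (p1 al) v;
  step_saturation_sum : forall q : elt T -> R,
    inner (fun K _ => S1 nonwet K + S1 wet K) (fun K _ => q K)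
    = inner (fun _ _ => 1) (fun K _ => q K);
  step_cap_pressure : forall q : elt T -> R,
    inner (fun K _ => p1 nonwet K - p1 wet K) (fun K _ => q K)
    = inner (fun K _ => cap_pressure P (S0 wet K)) (fun K _ => q K)
}.

End scheme.

Definition assumption_A1 (R : realType) (d : nat) (P : two_phase R d)
    (gam : phase -> R) : Prop :=
  forall al s, 0 <= s <= 1 -> frac_own P al s <= gam al * s.

(* A point where the source term vanishes is not a sink: with <= 0 in place of
   < 0, the lower bound b1 * S <= 0 would contradict 0 < S there. *)
Definition assumption_A2 (R : realType) (n : nat) (P : two_phase R n.+1)
    (T : mesh R n) (S : phase -> elt T -> R) (b1 b2 : R) : Prop :=
  forall al K x, open_simplex (vtx K) x -> source P al x < 0 ->
    b1 * S al K <= `|source P al x| <= b2 * S al K.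

(* Main.v *)
Require Import Defs.
From mathcomp Require Import all_boot all_order all_algebra.
From mathcomp Require Import all_classical all_reals all_analysis.
From mathcomp Require Import perm measurable_realfun ring lra.

Set Implicit Arguments.
Unset Strict Implicit.
Unset Printing Implicit Defensive.

Import Order.TTheory GRing.Theory Num.Theory.
Import numFieldNormedType.Exports.

Local Open Scope classical_set_scope.
Local Open Scope ring_scope.

(** Test the saturation equation of a phase with the indicator of an element [K].
    The mass of the phase in [K] then changes, during a step of length [dt], by
    [dt] times the source in [K] minus the fluxes through the faces of [K].

    The loss is bounded above ([mass_loss_le]).  The upwind saturations lie
    between 0 and 1 ([face_sat_w_bounds]), so the fractional flows do as well, and
    the total flux is at most [|boundary of K|] times the sum of the maximum norms
    [L] of the two discrete fields.  The sink term removes at most [b2 |K|] per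
    unit of time.  If the new saturation were not positive, the whole initial mass,
    at least [phi_lo * St * |K|] with [St] the tolerance saturation, would be lost:

      [phi_lo * St * |K| <= dt * (b2 * |K| + |boundary of K| * L)].

    For a shape-regular element of diameter [D], the faces have area at most of
    order [D ^ (d - 1)] ([area_factor_le]) and the volume is at least of order
    [D ^ d], since [K] contains a ball of radius comparable to [D]
    ([volume_elt_ge]).  Hence [|boundary of K| <= (C / D) |K| <= (C / h) |K|]
    ([sum_face_area_le]), where [h] is the mesh size.  Moreover [h <= D] is bounded
    by twice the diameter of the domain ([elt_diam_le_domain]), say by [H].
    Dividing by [|K|] gives [phi_lo * St <= (dt / h) * (b2 * H + C * L)], which
    fails when [dt / h] is small, the threshold depending on the discrete fields
    only through [L].

    Both new saturations are thus positive, and as they add up to 1 ([sat_sum1])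
    they are also smaller than 1.

    Integrands are compared with constants and volumes with volumes of boxes; the
    constants obtained in this way are not sharp, but only the powers of [D] and
    [h] matter. *)

(** * Bounds on integrals by comparison with constants *)

Section integral_bounds.
Context d (X : measurableType d) (R : realType).
Variables (mu : {measure set X -> \bar R}) (D : set X).
Implicit Types (f : X -> \bar R) (g : X -> R).
Local Open Scope ereal_scope.

(** The integral of a nonnegative function is a supremum over the simple
    functions below it, and enlarging the function enlarges that family of
    simple functions, whatever the integrands are. *)
Lemma ge0_le_integral_nomeas f1 f2 : (forall x, D x -> 0 <= f1 x) ->
  (forall x, D x -> f1 x <= f2 x) ->
  \int[mu]_(x in D) f1 x <= \int[mu]_(x in D) f2 x.
Proof.
move=> f10 f12.
have f20 x : D x -> 0 <= f2 x.
  by move=> Dx; apply: le_trans (f12 _ Dx); exact: f10.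
rewrite !ge0_integralE//; apply: ereal_sup_le => _ [h hf <-]; exists h => //= x.
apply: le_trans (hf x) _; rewrite /patch; case: ifP => // /[1!inE] Dx.
exact: f12.
Qed.

(** Changing sign exchanges the positive and negative parts.  When both have
    infinite integral, both sides are the default value 0 of [fine]. *)
Lemma RintegralN_nomeas g :
  (\int[mu]_(x in D) (- g x) = - \int[mu]_(x in D) g x)%R.
Proof.
rewrite /Rintegral -fineN integralE [in RHS]integralE.
rewrite (_ : (fun x => (- g x)%:E) = \- (EFin \o g))//.
rewrite funeposN funenegN.
pose p := \int[mu]_(x in D) (EFin \o g)^\+ x.
pose q := \int[mu]_(x in D) (EFin \o g)^\- x.
rewrite -/p -/q -[fine _]/(fine (q - p)) -[RHS]/(fine (- (p - q))).
by move: p q => [p| |] [q| |]//=; rewrite opprB.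
Qed.

Hypotheses (mD : measurable D) (finD : mu D < +oo).
Let m := fine (mu D).
Let mE : mu D = m%:E.
Proof. by rewrite /m fineK// ge0_fin_numE. Qed.
Let m0 : (0 <= m)%R. Proof. by rewrite /m fine_ge0. Qed.

Lemma ge_cst_integral f (a : R) : (0 <= a)%R ->
  (forall x, D x -> a%:E <= f x) ->
  (a * m)%:E <= \int[mu]_(x in D) f x.
Proof.
move=> a0 af; rewrite EFinM -mE -integral_cst//.
by apply: ge0_le_integral_nomeas => //= x Dx; rewrite lee_fin.
Qed.

Lemma le_cst_integral f (b : R) : (forall x, D x -> 0 <= f x) ->
  (forall x, D x -> f x <= b%:E) -> \int[mu]_(x in D) f x <= (b * m)%:E.
Proof.
by move=> f0 fb; rewrite EFinM -mE -integral_cst//; exact: ge0_le_integral_nomeas.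
Qed.

(** For [a <= 0] the negative part of [g] is at most [- a] and so has a finite
    integral.  The positive part may have an infinite one; the value of the
    integral is then 0, which still lies above [a * m]. *)
Lemma ge_npcst_Rintegral g (a : R) : (a <= 0)%R ->
  (forall x, D x -> (a <= g x)%R) -> (a * m <= \int[mu]_(x in D) g x)%R.
Proof.
move=> a0 ag; rewrite /Rintegral integralE.
set p := (X in X - _); set q := (X in _ - X).
have p0 : 0 <= p by apply: integral_ge0 => x _; exact: funepos_ge0.
have q0 : 0 <= q by apply: integral_ge0 => x _; exact: funeneg_ge0.
have qa : q <= (- a * m)%:E.
  apply: le_cst_integral => x Dx; first exact: funeneg_ge0.
  by rewrite funenegE -EFinN -EFin_max lee_fin ge_max lerN2 oppr_ge0 a0 ag.
have am : (a * m <= 0)%R by rewrite mulr_le0_ge0.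
move: p q p0 q0 qa => [p| |] [q| |]//=; rewrite ?lee_fin// => *; lra.
Qed.

(** For [0 <= a] an upper bound on [g] is required as well: an infinite integral
    would be read as 0, below [a * m]. *)
Lemma ge_nncst_Rintegral g (a b : R) : (0 <= a)%R ->
  (forall x, D x -> (a <= g x <= b)%R) -> (a * m <= \int[mu]_(x in D) g x)%R.
Proof.
move=> a0 ag.
have g0 x : D x -> 0 <= (g x)%:E.
  by move=> /ag /andP[+ _]; rewrite lee_fin; exact: le_trans.
have lo : (a * m)%:E <= \int[mu]_(x in D) (g x)%:E.
  by apply: ge_cst_integral => // x /ag /andP[].
have hi : \int[mu]_(x in D) (g x)%:E <= (b * m)%:E.
  by apply: le_cst_integral => // x /ag /andP[].
rewrite /Rintegral -lee_fin fineK// ge0_fin_numE.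
  exact: le_lt_trans hi (ltry _).
exact: integral_ge0.
Qed.

Lemma normr_Rintegral_le g (b : R) : (0 <= b)%R ->
  (forall x, D x -> (`|g x| <= b)%R) -> (`|\int[mu]_(x in D) g x| <= b * m)%R.
Proof.
move=> b0 gb; rewrite ler_norml; apply/andP; split.
  rewrite -mulNr; apply: ge_npcst_Rintegral; first by rewrite oppr_le0.
  by move=> x /gb; rewrite ler_norml => /andP[].
rewrite -lerN2 -RintegralN_nomeas -mulNr.
apply: ge_npcst_Rintegral; first by rewrite oppr_le0.
by move=> x /gb; rewrite lerN2 ler_norml => /andP[].
Qed.

End integral_bounds.

(** * The Euclidean norm and boxes *)

Section euclidean_norm.
Context (R : realType).

Lemma dotE d (x y : 'rV[R]_d) : dot x y = \sum_i x 0 i * y 0 i.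
Proof. by rewrite /dot !mxE; apply: eq_bigr => i _; rewrite !mxE. Qed.

Lemma dot_ge0 d (x : 'rV[R]_d) : 0 <= dot x x.
Proof. by rewrite dotE sumr_ge0// => i _; rewrite -expr2 sqr_ge0. Qed.

Lemma dot_eq0 d (x : 'rV[R]_d) : dot x x = 0 -> x = 0.
Proof.
rewrite dotE => /eqP; rewrite psumr_eq0 => [|i _]; last first.
  by rewrite -expr2 sqr_ge0.
move=> /allP x0; apply/rowP => i; rewrite mxE.
by have := x0 i (mem_index_enum _); rewrite /= mulf_eq0 orbb => /eqP.
Qed.

Lemma enorm_ge0 d (x : 'rV[R]_d) : 0 <= enorm x.
Proof. exact: sqrtr_ge0. Qed.

Lemma enorm_gt0 d (x : 'rV[R]_d) : x != 0 -> 0 < enorm x.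
Proof.
move=> x0; rewrite sqrtr_gt0 lt_neqAle dot_ge0 andbT eq_sym.
by apply: contra x0 => /eqP/dot_eq0 ->.
Qed.

Lemma dot_sub_scale d (x y : 'rV[R]_d) (t : R) :
  dot (x - t *: y) (x - t *: y) = dot x x - t * dot x y *+ 2 + t ^+ 2 * dot y y.
Proof.
rewrite !dotE mulr_sumr -sumrMnl -sumrB mulr_sumr -big_split/=.
by apply: eq_bigr => i _; rewrite !mxE; ring.
Qed.

(** Expand the square of the distance from [x] to its projection on the line
    spanned by [y]. *)
Lemma Cauchy_Schwarz_dot d (x y : 'rV[R]_d) : `|dot x y| <= enorm x * enorm y.
Proof.
rewrite /enorm -sqrtrM ?dot_ge0// -sqrtr_sqr ler_wsqrtr//.
have [y0|y0] := eqVneq (dot y y) 0.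
  by rewrite (dot_eq0 y0) [dot x 0]dotE big1 ?expr0n ?mulr_ge0 ?dot_ge0// => i _;
    rewrite mxE mulr0.
have yy : 0 < dot y y by rewrite lt_neqAle eq_sym y0 dot_ge0.
have := mulr_ge0 (dot_ge0 (x - (dot x y / dot y y) *: y)) (ltW yy).
rewrite dot_sub_scale => h; rewrite -subr_ge0; suff <- :
  (dot x x - dot x y / dot y y * dot x y *+ 2 +
   (dot x y / dot y y) ^+ 2 * dot y y) * dot y y =
  dot x x * dot y y - dot x y ^+ 2 by [].
by field.
Qed.

Lemma enormZ d (c : R) (x : 'rV[R]_d) : enorm (c *: x) = `|c| * enorm x.
Proof.
rewrite /enorm -sqrtr_sqr -sqrtrM ?sqr_ge0//; congr Num.sqrt.
by rewrite !dotE mulr_sumr; apply: eq_bigr => i _; rewrite !mxE; ring.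
Qed.

(** A crude comparison with the maximum norm: the factor [d] (instead of its
    square root) only affects constants. *)
Lemma enorm_le_coord d (x : 'rV[R]_d) (s : R) : 0 <= s ->
  (forall i, `|x 0 i| <= s) -> enorm x <= d%:R * s.
Proof.
move=> s0 xs; rewrite /enorm -[leRHS]ger0_norm ?mulr_ge0// -sqrtr_sqr ler_wsqrtr//.
rewrite dotE (@le_trans _ _ (\sum_(i < d) s ^+ 2))//.
  apply: ler_sum => i _; rewrite -expr2 -real_normK ?num_real//.
  by rewrite lerXn2r ?nnegrE.
rewrite exprMn sumr_const card_ord -[leLHS]mulr_natl ler_wpM2r ?sqr_ge0//.
by rewrite -natrX ler_nat; case: d {x xs} => // d; rewrite expnS leq_pmulr.
Qed.

End euclidean_norm.

Section box_volume.
Context (R : realType).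
Local Notation mR := (measurableTypeR R).

Definition box d (c : 'I_d -> R) (s : R) : set (d.-tuple mR) :=
  [set t | forall i, `|tnth t i - c i| <= s].

(** Boxes are the products along which the measure is built, so their volume
    follows by induction on the dimension; all the volume estimates below are
    reduced to it. *)
Lemma lebesgue_tuple_box d (c : 'I_d -> R) s : 0 <= s ->
  measurable (box c s) /\ lebesgue_tuple R d (box c s) = ((s *+ 2) ^+ d)%:E.
Proof.
move=> s0; elim: d c => [|d IH] c.
  rewrite (_ : box c s = setT); last by apply/seteqP; split=> // t _ [].
  by split=> //=; rewrite expr0 diracE in_setT.
pose c' i := c (lift ord0 i); have [mB vB] := IH c'.
pose I : set mR := `[c ord0 - s, c ord0 + s]%classic.
have mI : measurable I by exact: measurable_itv.
have Ix x : I x <-> `|x - c ord0| <= s.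
  by rewrite /I/= in_itv/= ler_distl.
have boxS : @cons_pair R d @^-1` box c s = I `*` box c' s.
  apply/seteqP; split => -[x t] /=.
    move=> b; split; first by apply/Ix; have := b ord0; rewrite (tnth_nth 0).
    by move=> i; have := b (lift ord0 i); rewrite !(tnth_nth 0).
  move=> [/Ix xI tB] i; have [j ->|->] := unliftP ord0 i.
    by have := tB j; rewrite !(tnth_nth 0).
  by rewrite (tnth_nth 0).
split.
  have -> : box c s = (fun t : d.+1.-tuple mR => (thead t, [tuple of behead t]))
      @^-1` (I `*` box c' s).
    rewrite -boxS -comp_preimage.
    rewrite (_ : _ \o _ = id) ?preimage_id//.
    by apply/funext => t; rewrite /cons_pair/=; apply/val_inj => /=; case: t => -[].
  rewrite -[X in measurable X]setTI.
  apply: measurable_fun_pair => //; last exact: measurableX.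
  - exact: (measurable_tnth ord0).
  - exact: measurable_behead.
rewrite /= /lebesgue_step /pushforward boxS product_measure1E//=.
rewrite vB lebesgue_measure_itv/= lte_fin -EFinD exprS EFinM.
congr (_ * _)%E; case: ifPn => [_|]; first by congr EFin; ring.
by rewrite -leNgt => ss; congr EFin; lra.
Qed.

End box_volume.

(** * Simplices *)

Section simplices.
Context (R : realType).
Local Notation mR := (measurableTypeR R).

Lemma barycentric_edge_mx m d (a : 'I_m.+1 -> 'rV[R]_d) (w : 'I_m.+1 -> R) :
  \sum_i w i = 1 ->
  \sum_i w i *: a i = a ord0 + (\row_k w (lift ord0 k)) *m edge_mx a.
Proof.
rewrite !big_ord_recl => w1; apply/rowP => j.
rewrite !mxE summxE [X in _ = _ + X](_ : _ =
    \sum_(k < m) (w (lift ord0 k) * a (lift ord0 k) 0 j) -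
    (\sum_(k < m) w (lift ord0 k)) * a ord0 0 j).
  rewrite (_ : \sum_(k < m) w (lift ord0 k) = 1 - w ord0); last by lra.
  rewrite (eq_bigr (fun k => w (lift ord0 k) * a (lift ord0 k) 0 j)) => [|k _].
    ring.
  by rewrite mxE.
by rewrite mulr_suml -sumrB; apply: eq_bigr => k _; rewrite !mxE mulrBr.
Qed.

(** Barycentric coordinates of the point with affine coordinates [t] in the
    frame given by vertex [ord0] and the edges issued from it. *)
Definition weights m (t : 'rV[R]_m) (i : 'I_m.+1) : R :=
  if unlift ord0 i is Some k then t 0 k else 1 - \sum_k t 0 k.

Lemma weights0 m (t : 'rV[R]_m) : weights t ord0 = 1 - \sum_k t 0 k.
Proof. by rewrite /weights unlift_none. Qed.

Lemma weights_lift m (t : 'rV[R]_m) k : weights t (lift ord0 k) = t 0 k.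
Proof. by rewrite /weights liftK. Qed.

Lemma sum_weights m (t : 'rV[R]_m) : \sum_i weights t i = 1.
Proof.
by rewrite big_ord_recl weights0 (eq_bigr _ (fun k _ => weights_lift t k)) subrK.
Qed.

Lemma weights_edge_mx m d (a : 'I_m.+1 -> 'rV[R]_d) (t : 'rV[R]_m) :
  \sum_i weights t i *: a i = a ord0 + t *m edge_mx a.
Proof.
rewrite barycentric_edge_mx ?sum_weights//; congr (_ + _ *m _).
by apply/rowP => k; rewrite mxE weights_lift.
Qed.

Lemma simplexP m d (a : 'I_m -> 'rV[R]_d) x : simplex a x <->
  exists w : 'I_m -> R, [/\ forall i, 0 <= w i, \sum_i w i = 1 &
                             x = \sum_i w i *: a i].
Proof.
split=> -[w]; first by case=> w0 _ w1 xE; exists w.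
by case=> w0 w1 xE; exists w; split=> // i; rewrite finset.in_setT.
Qed.

Lemma simplex_edge_mx m d (a : 'I_m.+1 -> 'rV[R]_d) (t : 'rV[R]_m) :
  reference_simplex t -> simplex a (a ord0 + t *m edge_mx a).
Proof.
move=> [t0 t1]; apply/simplexP; exists (weights t); split.
- move=> i; have [k ->|->] := unliftP ord0 i; first by rewrite weights_lift.
  by rewrite weights0 subr_ge0.
- exact: sum_weights.
- by rewrite weights_edge_mx.
Qed.

(** With [f := lift j] this says that a face lies in its element. *)
Lemma simplex_comp m k d (a : 'I_m -> 'rV[R]_d) (f : 'I_k -> 'I_m) :
  simplex (a \o f) `<=` simplex a.
Proof.
move=> x /simplexP[w [w0 w1 xE]]; apply/simplexP.
exists (fun i => \sum_(j | f j == i) w j); split.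
- by move=> i; apply: sumr_ge0.
- by rewrite -w1 [RHS](partition_big f predT).
- rewrite xE (partition_big f predT)//=; apply: eq_bigr => i _.
  by rewrite scaler_suml; apply: eq_bigr => j /eqP ->.
Qed.

(** Averaging with an interior point moves a closed simplex into its interior at
    the cost of halving distances.  This is how facts about closed elements (an
    inscribed ball, the diameter) are transported to open ones. *)
Lemma open_simplex_mid m d (a : 'I_m -> 'rV[R]_d) x y :
  simplex a x -> open_simplex a y -> open_simplex a (2^-1 *: (x + y)).
Proof.
move=> /simplexP[w [w0 w1 ->]] [v [v0 v1 ->]].
exists (fun i => 2^-1 * (w i + v i)); split.
- by move=> i; rewrite mulr_gt0 ?invr_gt0// ltr_wpDl.
- by rewrite -mulr_sumr big_split/= w1 v1; lra.
- rewrite -big_split scaler_sumr; apply: eq_bigr => i _ /=.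
  by rewrite -scalerDl scalerA.
Qed.

Lemma open_simplex_barycenter m d (a : 'I_m.+1 -> 'rV[R]_d) :
  open_simplex a (\sum_i (m.+1%:R)^-1 *: a i).
Proof.
exists (fun=> m.+1%:R^-1); split=> //.
by rewrite sumr_const card_ord -[LHS]mulr_natl divff// pnatr_eq0.
Qed.

Lemma open_simplex_sub m d (a : 'I_m -> 'rV[R]_d) :
  open_simplex a `<=` simplex a.
Proof.
move=> x [w [w0 w1 xE]]; apply/simplexP; exists w; split=> // i.
exact/ltW.
Qed.

Lemma simplex_vertex m d (a : 'I_m -> 'rV[R]_d) j : simplex a (a j).
Proof.
apply/simplexP; exists (fun i => (i == j)%:R); split=> //.
- by rewrite (bigD1 j)//= eqxx big1 ?addr0// => i /negPf ->.
- rewrite (bigD1 j)//= eqxx scale1r big1 ?addr0// => i /negPf ->.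
  by rewrite scale0r.
Qed.

Lemma simplex_coord_le m d (a : 'I_m -> 'rV[R]_d) x i : simplex a x ->
  `|x 0 i| <= \sum_k `|a k 0 i|.
Proof.
move=> /simplexP[w [w0 w1 ->]]; rewrite summxE.
apply: le_trans (ler_norm_sum _ _ _) _; apply: ler_sum => k _.
rewrite mxE normrM ger0_norm// ler_piMl// -w1 (bigD1 k)//= lerDl.
by apply: sumr_ge0 => j _.
Qed.

Lemma simplex_coord_bounded m d (a : 'I_m -> 'rV[R]_d) x : simplex a x ->
  forall i, `|x 0 i| <= \sum_i \sum_k `|a k 0 i|.
Proof.
move=> xa i; apply: le_trans (simplex_coord_le i xa) _.
rewrite (bigD1 i)//= lerDl; apply: sumr_ge0 => j _.
by apply: sumr_ge0.
Qed.

(** When the edges are independent, barycentric coordinates are affine functions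
    of the point, so an open simplex is an intersection of finitely many open
    half-spaces; it is therefore both open and measurable. *)
Lemma open_simplex_halfspaces m (a : 'I_m.+1 -> 'rV[R]_m) :
  \det (edge_mx a) != 0 ->
  exists (b : 'I_m.+1 -> R) (l : 'I_m.+1 -> 'I_m -> R), forall x,
    open_simplex a x <-> forall i, 0 < b i + \sum_k x 0 k * l i k.
Proof.
move=> det0; have aU : edge_mx a \in unitmx by rewrite unitmxE unitfE.
pose M := invmx (edge_mx a); pose bary x := (x - a ord0) *m M.
have E x : open_simplex a x <-> forall i, 0 < weights (bary x) i.
  split=> [[w [w0 w1 xE]]|w0]; last first.
    exists (weights (bary x)); split=> //; first exact: sum_weights.
    by rewrite weights_edge_mx /bary /M mulmxKV// addrC subrK.
  suff wE : bary x = \row_k w (lift ord0 k).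
    move=> i; have [k ->|->] := unliftP ord0 i.
      by rewrite weights_lift wE mxE.
    rewrite weights0 wE (eq_bigr (fun k => w (lift ord0 k))) => [|k _].
      by rewrite -w1 big_ord_recl addrK.
    by rewrite mxE.
  by rewrite /bary xE barycentric_edge_mx// addrC addKr /M mulmxK.
pose l k j := M j k.
pose b k := - (a ord0 *m M) 0 k.
have baryE x k : bary x 0 k = b k + \sum_j x 0 j * l k j.
  by rewrite /bary mulmxBl !mxE addrC /b mxE.
(* The coordinate at vertex [ord0] is 1 minus the sum of the other ones. *)
exists (fun i => if unlift ord0 i is Some k then b k else 1 - \sum_k b k).
exists (fun i j => if unlift ord0 i is Some k then l k j else - \sum_k l k j).
move=> x; rewrite E.
suff wE i : weights (bary x) i =
    (if unlift ord0 i is Some k then b k else 1 - \sum_k b k) + \sum_j x 0 j *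
    (if unlift ord0 i is Some k then l k j else - \sum_k l k j).
  by split=> h i; have := h i; rewrite wE.
have [k ->|->] := unliftP ord0 i; first by rewrite weights_lift baryE.
rewrite weights0 -addrA; congr (_ + _).
rewrite (eq_bigr _ (fun k _ => baryE x k)) big_split/= opprD; congr (_ + _).
rewrite exchange_big -sumrN; apply: eq_bigr => j _ /=.
by rewrite mulrN mulr_sumr.
Qed.

Lemma open_open_simplex m (a : 'I_m.+1 -> 'rV[R]_m) :
  \det (edge_mx a) != 0 -> open (open_simplex a).
Proof.
move=> /open_simplex_halfspaces[b [l aE]].
rewrite openE => x /aE xa.
suff : nbhs x (fun y => forall i, 0 < b i + \sum_k y 0 k * l i k).
  by apply: filterS => y /aE.
apply: (@filter_forall _ _ (fun i (y : 'rV[R]_m) =>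
  0 < b i + \sum_k y 0 k * l i k) (nbhs x) _) => i.
have c : {for x, continuous (fun y : 'rV[R]_m => b i + \sum_k y 0 k * l i k)}.
  apply: continuousD; first exact: cst_continuous.
  apply: (continuous_big (P := xpredT) (@add_continuous R)) => k _ y.
  apply: continuousM; last exact: cst_continuous.
  exact: coord_continuous.
have : nbhs (b i + \sum_k x 0 k * l i k) [set r : R | 0 < r].
  exact: (lt_nbhsr (xa i)).
by move/c.
Qed.

Lemma measurable_open_simplex m (a : 'I_m.+1 -> 'rV[R]_m) :
  \det (edge_mx a) != 0 -> measurable (@row_of_tuple R m @^-1` open_simplex a).
Proof.
move=> /open_simplex_halfspaces[b [l aE]].
rewrite (_ : _ @^-1` _ = \bigcap_(i in [set: 'I_m.+1])
    ((fun t : m.-tuple mR => b i + \sum_k tnth t k * l i k) @^-1` `]0, +oo[)).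
  apply: fin_bigcap_measurable => // i _.
  rewrite -[X in measurable X]setTI.
  apply: measurable_funD => //; apply: measurable_sum => k.
  by apply: measurable_funM => //; exact: measurable_tnth.
have rE t i : \sum_k (row_of_tuple t) 0 k * l i k = \sum_k tnth t k * l i k.
  by apply: eq_bigr => k _; rewrite mxE.
apply/seteqP; split => t /=.
  by move=> /aE h i _ /=; rewrite in_itv/= andbT -rE.
by move=> h; apply/aE => i; have := h i I; rewrite /= in_itv/= andbT rE.
Qed.

Lemma measurable_reference_simplex m :
  measurable (@row_of_tuple R m @^-1` (@reference_simplex R m)).
Proof.
rewrite (_ : _ @^-1` _ = \bigcap_(i in [set: 'I_m])
    ((fun t : m.-tuple mR => tnth t i) @^-1` `[0, +oo[) `&`
   ((fun t : m.-tuple mR => \sum_k tnth t k) @^-1` `]-oo, 1])).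
  apply: measurableI.
    apply: fin_bigcap_measurable => // i _.
    rewrite -[X in measurable X]setTI.
    exact: measurable_tnth.
  rewrite -[X in measurable X]setTI.
  by apply: measurable_sum => // k; exact: measurable_tnth.
have rE t : \sum_k (row_of_tuple t) 0 k = \sum_k tnth t k :> R.
  by apply: eq_bigr => k _; rewrite mxE.
apply/seteqP; split => t /=.
  move=> [t0 t1]; split.
    by move=> i _ /=; rewrite in_itv/= andbT; have := t0 i; rewrite mxE.
  by rewrite /= in_itv/= -rE.
move=> [t0 t1]; split.
  by move=> i; rewrite mxE; have := t0 i I; rewrite /= in_itv/= andbT.
by move: t1; rewrite /= in_itv/= -rE.
Qed.

End simplices.

(** * Volumes of elements and areas of faces *)

Section volumes.
Context (R : realType).

Definition volume d (E : set 'rV[R]_d) : R :=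
  fine (lebesgue_tuple R d (@row_of_tuple R d @^-1` E)).

Lemma volume_bounded_fin d (E : set 'rV[R]_d) (M : R) :
  measurable (@row_of_tuple R d @^-1` E) ->
  (forall x, E x -> forall i, `|x 0 i| <= M) ->
  (lebesgue_tuple R d (@row_of_tuple R d @^-1` E) < +oo)%E.
Proof.
move=> mE EM.
have [mB vB] := lebesgue_tuple_box (fun _ : 'I_d => 0 : R) (normr_ge0 M).
apply: (@le_lt_trans _ _ (lebesgue_tuple R d (box (fun _ : 'I_d => 0) `|M|))).
  apply: le_measure; rewrite ?inE// => t Et i.
  rewrite subr0; have := EM _ Et i; rewrite mxE => /le_trans; apply.
  exact: ler_norm.
by rewrite vB ltry.
Qed.

Lemma reference_simplex_fin m :
  (lebesgue_tuple R m (@row_of_tuple R m @^-1` (@reference_simplex R m)) < +oo)%E.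
Proof.
apply: (@volume_bounded_fin _ _ 1); first exact: measurable_reference_simplex.
move=> t [t0 t1] i; rewrite ger0_norm//; apply: le_trans t1.
by rewrite (bigD1 i)//= lerDl; apply: sumr_ge0.
Qed.

Lemma volume_ge_box d (E : set 'rV[R]_d) (c : 'I_d -> R) (s : R) : 0 <= s ->
  measurable (@row_of_tuple R d @^-1` E) ->
  (lebesgue_tuple R d (@row_of_tuple R d @^-1` E) < +oo)%E ->
  (forall x : 'rV[R]_d, (forall i, `|x 0 i - c i| <= s) -> E x) ->
  (s *+ 2) ^+ d <= volume E.
Proof.
move=> s0 mE finE bE; have [mB vB] := lebesgue_tuple_box c s0.
rewrite -lee_fin -vB /volume fineK ?ge0_fin_numE//.
apply: le_measure; rewrite ?inE// => t tB; apply: bE => i.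
by rewrite mxE; exact: tB.
Qed.

(** The cube of side [1 / (m + 1)] at the origin fits in the reference
    simplex. *)
Lemma volume_reference_simplex_gt0 m : 0 < volume (@reference_simplex R m).
Proof.
pose s : R := m.+1%:R^-1 / 2.
have s0 : 0 < s by rewrite divr_gt0// invr_gt0 ltr0n.
apply: (@lt_le_trans _ _ ((s *+ 2) ^+ m)); first by rewrite exprn_gt0// mulrn_wgt0.
apply: (@volume_ge_box _ _ (fun=> s)); rewrite ?ltW//.
- exact: measurable_reference_simplex.
- exact: reference_simplex_fin.
move=> x xs.
have x02 i : 0 <= x 0 i <= s *+ 2.
  by have := xs i; rewrite ler_norml => /andP[? ?]; apply/andP; split; lra.
split=> [i|]; first by have /andP[] := x02 i.
apply: (@le_trans _ _ (\sum_(i < m) s *+ 2)).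
  by apply: ler_sum => i _; have /andP[] := x02 i.
rewrite sumr_const card_ord -[leLHS]mulr_natl.
rewrite (_ : s *+ 2 = m.+1%:R^-1); last by rewrite /s -[LHS]mulr_natr divfK.
by rewrite ler_pdivrMr ?ltr0n// mul1r ler_nat.
Qed.

Lemma open_simplex_fin m (a : 'I_m.+1 -> 'rV[R]_m) : \det (edge_mx a) != 0 ->
  (lebesgue_tuple R m (@row_of_tuple R m @^-1` open_simplex a) < +oo)%E.
Proof.
move=> det0.
apply: (@volume_bounded_fin _ _ (\sum_i \sum_k `|a k 0 i|)).
  exact: measurable_open_simplex.
by move=> x /open_simplex_sub; exact: simplex_coord_bounded.
Qed.

(** Half the inscribed ball, recentred towards the barycentre, lies in the open
    simplex, and the cube inscribed in that half ball has side [r / m.+1].  A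
    cube is enough here, as only the order of growth in [r] matters. *)
Lemma volume_open_simplex_ge m (a : 'I_m.+2 -> 'rV[R]_m.+1) (c : 'rV[R]_m.+1) r :
  \det (edge_mx a) != 0 -> 0 <= r ->
  (forall x, enorm (x - c) <= r -> simplex a x) ->
  (r / m.+1%:R) ^+ m.+1 <= volume (open_simplex a).
Proof.
move=> det0 r0 ball.
pose b := \sum_i (m.+2%:R)^-1 *: a i.
pose s := r / m.+1%:R / 2.
have s0 : 0 <= s by rewrite !divr_ge0.
have -> : r / m.+1%:R = s *+ 2 by rewrite /s -[RHS]mulr_natr divfK.
apply: (@volume_ge_box _ _ (fun i => (2^-1 *: (c + b)) 0 i)) => //.
- exact: measurable_open_simplex.
- exact: open_simplex_fin.
move=> x xs.
have -> : x = 2^-1 *: ((2 *: x - b) + b) by rewrite subrK scalerA mulVf ?scale1r.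
apply: open_simplex_mid; last exact: open_simplex_barycenter.
apply: ball.
have -> : r = m.+1%:R * (s *+ 2).
  by rewrite /s -[_ *+ 2]mulr_natr divfK// mulrC divfK ?pnatr_eq0.
apply: enorm_le_coord => [|i]; first by rewrite mulrn_wge0.
have := xs i; rewrite !mxE !ler_norml => /andP[? ?].
by apply/andP; split; lra.
Qed.

(** Leibniz formula: the determinant is a sum of [m`!] products of [m]
    entries. *)
Lemma det_norm_le m (A : 'M[R]_m) (B : R) :
  (forall i j, `|A i j| <= B) -> `|\det A| <= m`!%:R * B ^+ m.
Proof.
move=> AB; apply: le_trans (ler_norm_sum _ _ _) _.
apply: (@le_trans _ _ (\sum_(s : 'S_m) B ^+ m)).
  apply: ler_sum => s _; rewrite normrMsign normr_prod.
  apply: le_trans (ler_prod _ _ (E2 := fun=> B)) _ => [i _|].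
    by rewrite normr_ge0 AB.
  by rewrite prodr_const card_ord.
by rewrite sumr_const card_Sn mulr_natl.
Qed.

Definition area_factor m d (a : 'I_m.+1 -> 'rV[R]_d) : R :=
  Num.sqrt (\det (edge_mx a *m (edge_mx a)^T)).

(** The entries of the Gram matrix are scalar products of edges, hence at most
    [D ^+ 2] by Cauchy-Schwarz. *)
Lemma area_factor_le m d (a : 'I_m.+1 -> 'rV[R]_d) (D : R) : 0 <= D ->
  (forall i, enorm (a (lift ord0 i) - a ord0) <= D) ->
  area_factor a <= Num.sqrt m`!%:R * D ^+ m.
Proof.
move=> D0 aD; rewrite /area_factor -[D ^+ m]ger0_norm ?exprn_ge0// -sqrtr_sqr.
rewrite -sqrtrM ?ler0n//; apply: ler_wsqrtr.
apply: le_trans (ler_norm _) _; rewrite -exprM mulnC exprM.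
apply: det_norm_le => i j.
rewrite (_ : _ i j = dot (a (lift ord0 i) - a ord0) (a (lift ord0 j) - a ord0)).
  apply: le_trans (Cauchy_Schwarz_dot _ _) _.
  by rewrite expr2 ler_pM ?enorm_ge0.
by rewrite dotE mxE; apply: eq_bigr => k _; rewrite !mxE.
Qed.

Lemma surf_integral_norm_le m d (a : 'I_m.+1 -> 'rV[R]_d) g (B : R) : 0 <= B ->
  (forall x, simplex a x -> `|g x| <= B) ->
  `|surf_integral a g| <= area_factor a * (B * volume (@reference_simplex R m)).
Proof.
move=> B0 gB; rewrite /surf_integral normrM ger0_norm ?sqrtr_ge0//.
rewrite ler_wpM2l ?sqrtr_ge0//; apply: normr_Rintegral_le => //.
- exact: measurable_reference_simplex.
- exact: reference_simplex_fin.
by move=> t Dt; apply: gB; exact: simplex_edge_mx.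
Qed.

(** Testing the projection with [q := 1] makes the integral of [g - c] vanish.
    If [c < 0] or [c > 1], then [g - c] would have a constant sign and be bounded
    away from 0 on a set of positive measure.  For a degenerate face every
    constant is a projection, whence the hypothesis on the area. *)
Lemma L2_projection_const_bounds m d (a : 'I_m.+1 -> 'rV[R]_d) (g : 'rV[R]_d -> R) :
  area_factor a != 0 -> (forall x, 0 <= g x <= 1) ->
  0 <= L2_projection_const a g <= 1.
Proof.
move=> af0 g01; rewrite /L2_projection_const.
case: xgetP => [c _ /= cP|_]; last by rewrite lexx ler01.
have mr := @measurable_reference_simplex R m.
have fr := reference_simplex_fin m.
have vr := volume_reference_simplex_gt0 m.
have := cP 1; rewrite /surf_integral -/(area_factor a) => /eqP.
rewrite mulf_eq0 (negPf af0)/= => /eqP; rewrite /vol_integral.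
set h := fun t => _; move=> h0; apply/andP; split; rewrite leNgt; apply/negP => c0.
  have : - c * volume (@reference_simplex R m) <= 0.
    rewrite -h0; apply: (@ge_nncst_Rintegral _ _ _ _ _ mr fr _ (- c) (1 - c)) => //.
      by rewrite oppr_ge0 ltW.
    move=> t _; rewrite /h/=; set gt := g _.
    by have /andP[? ?] : 0 <= gt <= 1 := g01 _; apply/andP; split; lra.
  by rewrite leNgt mulr_gt0 ?oppr_gt0.
have : (c - 1) * volume (@reference_simplex R m) <= 0.
  rewrite -oppr0 -h0 -RintegralN_nomeas.
  apply: (@ge_nncst_Rintegral _ _ _ _ _ mr fr _ (c - 1) c) => //.
    by rewrite subr_ge0 ltW.
  move=> t _; rewrite /h/=; set gt := g _.
  by have /andP[? ?] : 0 <= gt <= 1 := g01 _; apply/andP; split; lra.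
by rewrite leNgt mulr_gt0 ?subr_gt0.
Qed.

End volumes.

(** * Mesh geometry *)

Section diameter.
Context (R : realType).

Definition diameter d (A : set 'rV[R]_d) : R :=
  sup [set r | exists x y, [/\ A x, A y & r = enorm (x - y)]].

Lemma enorm_le_diameter d (A : set 'rV[R]_d) (M : R) :
  (forall x, A x -> forall i, `|x 0 i| <= M) ->
  forall x y, A x -> A y -> enorm (x - y) <= diameter A.
Proof.
move=> AM x y Ax Ay; apply: ub_le_sup; last by exists x, y.
exists (d%:R * (`|M| + `|M|)) => _ [u [v [Au Av ->]]].
apply: enorm_le_coord => [|i]; first by rewrite addr_ge0.
rewrite !mxE; apply: le_trans (ler_normB _ _) _.
by apply: lerD; (apply: le_trans (ler_norm M)); apply: AM.
Qed.

Lemma diameter_le d (A : set 'rV[R]_d) (B : R) : A !=set0 ->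
  (forall x y, A x -> A y -> enorm (x - y) <= B) -> diameter A <= B.
Proof.
move=> [z Az] AB; apply: ge_sup; first by exists (enorm (z - z)), z, z.
by move=> _ [x [y [Ax Ay ->]]]; exact: AB.
Qed.

End diameter.

Section mesh_estimates.
Context (R : realType) (n : nat) (T : mesh R n).
Local Notation point := 'rV[R]_n.+1.
Implicit Types (K : elt T) (j : 'I_n.+2).

Lemma enorm_le_elt_diam K x y : simplex (vtx K) x -> simplex (vtx K) y ->
  enorm (x - y) <= elt_diam K.
Proof. by apply: enorm_le_diameter => z /simplex_coord_bounded. Qed.

Lemma elt_diam_gt0 K : 0 < elt_diam K.
Proof.
apply: (@lt_le_trans _ _ (enorm (vtx K (lift ord0 ord0) - vtx K ord0))).
  apply: enorm_gt0; apply: contraNneq (vtx_nondegenerate K) => v0.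
  rewrite (expand_det_row _ ord0) big1// => k _.
  by rewrite mxE v0 mxE mul0r.
by apply: enorm_le_elt_diam; exact: simplex_vertex.
Qed.

Lemma mesh_size_le K : mesh_size T <= elt_diam K.
Proof.
apply: ge_inf; last by exists K.
by exists 0 => _ [K' _ <-]; exact/ltW/elt_diam_gt0.
Qed.

(** The infimum over the finitely many elements is attained. *)
Lemma mesh_size_gt0 K : 0 < mesh_size T.
Proof.
have [//|K0 _ K0min] :=
  @Order.TotalTheory.arg_minP _ _ _ K xpredT (@elt_diam R n T).
apply: (lt_le_trans (elt_diam_gt0 K0)); apply: lb_le_inf.
  by exists (elt_diam K), K.
by move=> _ [K' _ <-]; exact: K0min.
Qed.

(** The supremum defining the inradius need not be attained a priori, so a radius
    larger than half of it is taken: the constant is [4 * kappa] instead of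
    [2 * kappa].  The set of radii has a supremum, for otherwise [sup] would be 0
    and the element would have diameter 0.  That the diameter is positive also
    gives [0 < kappa]. *)
Lemma quasi_uniform_ball kappa K : quasi_uniform T kappa ->
  0 < kappa /\ exists (r : R) (c : point), [/\ 0 <= r,
    forall x, enorm (x - c) <= r -> simplex (vtx K) x &
    elt_diam K <= 4 * kappa * r].
Proof.
move=> /(_ K)[qu _]; have D0 := elt_diam_gt0 K.
move: qu; rewrite /inradius; set E := (X in sup X) => qu.
have supE : has_sup E.
  by apply: contrapT => /sup_out E0; move: qu; rewrite E0 !mulr0 leNgt D0.
have rho_ge0 : 0 <= sup E.
  case: (supE) => -[r Er] _; apply: le_trans (sup_upper_bound supE Er).
  by case: Er.
have rho_gt0 : 0 < sup E.
  rewrite lt_neqAle rho_ge0 andbT; apply: contraTneq D0 => E0.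
  by rewrite -leNgt; apply: le_trans qu _; rewrite -E0 !mulr0.
have kappa0 : 0 < kappa.
  by have := lt_le_trans D0 qu; rewrite pmulr_lgt0// mulr_gt0.
split=> //; have e0 : 0 < sup E / 2 by rewrite divr_gt0.
have [r [r0 [c cr]] rE] := sup_adherent e0 supE.
exists r, c; split=> //; apply: le_trans qu _.
have : kappa * sup E <= kappa * (2 * r) by rewrite ler_pM2l//; lra.
by move=> ?; lra.
Qed.

(** Shape regularity is used here: the volume of an element is of the order of
    its diameter to the power of the dimension. *)
Lemma volume_elt_ge kappa K : quasi_uniform T kappa ->
  elt_diam K ^+ n.+1 <=
    (4 * kappa * n.+1%:R) ^+ n.+1 * volume (open_simplex (vtx K)).
Proof.
move=> /(@quasi_uniform_ball _ K)[k0 [r [c [r0 ball Dr]]]].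
have := volume_open_simplex_ge (vtx_nondegenerate K) r0 ball.
have k1 : 0 < 4 * kappa * n.+1%:R by rewrite !mulr_gt0// ltr0n.
move=> h; rewrite -ler_pdivrMl ?exprn_gt0//; apply: le_trans h.
rewrite mulrC -expr_div_n; apply: lerXn2r.
- by rewrite nnegrE divr_ge0// ltW// elt_diam_gt0.
- by rewrite nnegrE divr_ge0.
rewrite ler_pdivrMr//.
have n0 : n.+1%:R != 0 :> R by rewrite pnatr_eq0.
rewrite (_ : r / _ * _ = 4 * kappa * r)//.
by move: (n.+1%:R) n0 => N N0; field.
Qed.

Lemma volume_elt_gt0 kappa K : quasi_uniform T kappa ->
  0 < volume (open_simplex (vtx K)).
Proof.
move=> qu; have [k0 _] := quasi_uniform_ball K qu.
have := lt_le_trans _ (volume_elt_ge K qu).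
move=> /(_ 0); rewrite exprn_gt0 ?elt_diam_gt0// => /(_ isT).
by rewrite pmulr_rgt0// exprn_gt0// !mulr_gt0// ltr0n.
Qed.

Lemma open_simplex_sub_domain Om K : mesh_of T Om -> open_simplex (vtx K) `<=` Om.
Proof.
move=> ->; rewrite -open_subsetE; last exact/open_open_simplex/vtx_nondegenerate.
by move=> x xK; exists K => //; exact: open_simplex_sub.
Qed.

(** This bounds the mesh size in terms of the domain alone.  The domain is bounded
    because finitely many simplices cover it; it need not contain the vertices
    of the element, so two points of the element are first averaged with the
    barycentre. *)
Lemma elt_diam_le_domain Om K : mesh_of T Om -> elt_diam K <= 2 * diameter Om.
Proof.
move=> OmE; apply: diameter_le.
  by exists (vtx K ord0); exact: simplex_vertex.
move=> x y Kx Ky; have Kb := open_simplex_barycenter (vtx K).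
have mx := open_simplex_sub_domain OmE (open_simplex_mid Kx Kb).
have my := open_simplex_sub_domain OmE (open_simplex_mid Ky Kb).
have bOm z : Om z -> forall i,
    `|z 0 i| <= \sum_(K' : elt T) \sum_i \sum_k `|vtx K' k 0 i|.
  rewrite OmE => /interior_subset[K' _ zK'] i.
  apply: le_trans (simplex_coord_bounded zK' i) _.
  rewrite (bigD1 K')//= lerDl; apply: sumr_ge0 => K'' _.
  by apply: sumr_ge0 => ? _; apply: sumr_ge0.
have := enorm_le_diameter bOm mx my.
rewrite -scalerBr opprD addrACA subrr addr0 enormZ ger0_norm ?invr_ge0//.
by rewrite ler_pdivrMl.
Qed.

(** The supremum [Linf_norm v] is over a bounded set: on each of the finitely many
    elements a Raviart-Thomas field is affine. *)
Lemma enorm_le_Linf (v : vfield T) K x : RT0 v -> simplex (vtx K) x ->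
  enorm (v K x) <= Linf_norm v.
Proof.
move=> [vaff _] Kx; apply: ub_le_sup; last by exists K, x.
have vbd K' : exists B : R, 0 <= B /\
    forall y, simplex (vtx K') y -> enorm (v K' y) <= B.
  have [a [b vE]] := vaff K'.
  pose M := \sum_i \sum_k `|vtx K' k 0 i|.
  have M0 : 0 <= M by apply: sumr_ge0 => i _; exact: sumr_ge0.
  exists (n.+1%:R * (\sum_i `|a 0 i| + `|b| * M)).
  have s0 : 0 <= \sum_i `|a 0 i| + `|b| * M.
    by rewrite addr_ge0 ?mulr_ge0// sumr_ge0.
  split=> [|y Ky]; first by rewrite mulr_ge0.
  rewrite vE; apply: enorm_le_coord => // i.
  rewrite !mxE; apply: le_trans (ler_normD _ _) _; apply: lerD.
    by rewrite (bigD1 i)//= lerDl; exact: sumr_ge0.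
  by rewrite normrM ler_wpM2l//; exact: simplex_coord_bounded.
have [B BP] := choice vbd.
exists (\sum_K B K) => _ [K' [y [Ky ->]]].
have [_ /(_ _ Ky) h] := BP K'; apply: le_trans h _.
by rewrite (bigD1 K')//= lerDl; apply: sumr_ge0 => K'' _; have [] := BP K''.
Qed.

Lemma Linf_norm_ge0 (v : vfield T) K : RT0 v -> 0 <= Linf_norm v.
Proof.
move=> vRT; apply: le_trans (enorm_ge0 _) _.
exact: (enorm_le_Linf vRT (simplex_vertex (vtx K) ord0)).
Qed.

Lemma enorm_outward_normal_le K j : enorm (outward_normal K j) <= 1.
Proof.
rewrite /outward_normal; case: xgetP => [nu _ [-> //]|_].
by rewrite /enorm [dot 0 0]dotE big1 ?sqrtr0// => i _; rewrite mxE mul0r.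
Qed.

Lemma normal_comp_le (v : vfield T) K j x : RT0 v -> face K j x ->
  `|normal_comp v K j x| <= Linf_norm v.
Proof.
move=> vRT /(@simplex_comp _ _ _ _ (vtx K) (lift j)) Kx.
apply: le_trans (Cauchy_Schwarz_dot _ _) _.
apply: (@le_trans _ _ (enorm (v K x) * 1)).
  by rewrite ler_wpM2l ?enorm_ge0// enorm_outward_normal_le.
by rewrite mulr1; exact: enorm_le_Linf.
Qed.

Definition face_area K j : R :=
  area_factor (face_vtx K j) * volume (@reference_simplex R n).

(** On a degenerate face the integral is 0 whatever the coefficient is, so the
    latter is only controlled on the other faces. *)
Lemma flux_le (v : vfield T) K j (f : R) : RT0 v ->
  (area_factor (face_vtx K j) != 0 -> 0 <= f <= 1) ->
  `|surf_integral (face_vtx K j) (fun x => f * normal_comp v K j x)| <=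
  face_area K j * Linf_norm v.
Proof.
move=> vRT f01; have L0 := Linf_norm_ge0 K vRT.
have [a0|/f01/andP[f0 f1]] := eqVneq (area_factor (face_vtx K j)) 0.
  rewrite /surf_integral -/(area_factor (face_vtx K j)) a0 mul0r normr0.
  by rewrite /face_area a0 !mul0r.
rewrite /face_area mulrAC -mulrA; apply: surf_integral_norm_le => // x xf.
rewrite normrM ger0_norm//; apply: le_trans (normal_comp_le vRT xf).
by rewrite ler_piMl.
Qed.

(** The face areas are at most of order [elt_diam K ^+ n], the volume is at least
    of order [elt_diam K ^+ n.+1]: the ratio of the boundary area of an element
    to its volume is at most of order [1 / elt_diam K]. *)
Lemma sum_face_area_le kappa K : quasi_uniform T kappa ->
  elt_diam K * (\sum_j face_area K j) <=
  n.+2%:R * (Num.sqrt n`!%:R * volume (@reference_simplex R n)) *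
    (4 * kappa * n.+1%:R) ^+ n.+1 * volume (open_simplex (vtx K)).
Proof.
move=> qu; have D0 := elt_diam_gt0 K; have V0 := volume_reference_simplex_gt0 R n.
apply: (@le_trans _ _ (elt_diam K * \sum_(j < n.+2)
    (Num.sqrt n`!%:R * elt_diam K ^+ n * volume (@reference_simplex R n)))).
  rewrite ler_pM2l//; apply: ler_sum => j _; rewrite /face_area ler_pM2r//.
  apply: area_factor_le; first exact: ltW.
  by move=> i; apply: enorm_le_elt_diam; exact: simplex_vertex.
rewrite sumr_const card_ord -[_ *+ n.+2]mulr_natl -[leRHS]mulrA.
apply: le_trans (ler_wpM2l _ (volume_elt_ge K qu)); last first.
  by rewrite mulr_ge0// mulr_ge0 ?sqrtr_ge0 ?ltW.
by rewrite le_eqVlt; apply/orP; left; apply/eqP; rewrite exprS; ring.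
Qed.

End mesh_estimates.

(** * The mass balance of one element *)

Section one_element.
Context (R : realType) (n : nat) (P : two_phase R n.+1) (T : mesh R n).
Local Notation point := 'rV[R]_n.+1.
Implicit Types (K : elt T) (j : 'I_n.+2).

Definition elt_indicator K (K' : elt T) : R := (K' == K)%:R.

Lemma vol_integral0 d (E : set 'rV[R]_d) (g : 'rV[R]_d -> R) :
  (forall x, g x = 0) -> vol_integral E g = 0.
Proof.
move=> g0; rewrite /vol_integral /Rintegral integral0_eq// => x _.
by rewrite g0.
Qed.

Lemma surf_integral0 m d (a : 'I_m.+1 -> 'rV[R]_d) (g : 'rV[R]_d -> R) :
  (forall x, g x = 0) -> surf_integral a g = 0.
Proof. by move=> g0; rewrite /surf_integral vol_integral0 ?mulr0. Qed.

Lemma inner_indicator (f : elt T -> point -> R) K :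
  inner f (fun K' _ => elt_indicator K K') =
  vol_integral (open_simplex (vtx K)) (f K).
Proof.
rewrite /inner (bigD1 K)//= big1 => [|K' K'K]; last first.
  by apply: vol_integral0 => x; rewrite /elt_indicator (negPf K'K) mulr0.
rewrite addr0 /elt_indicator eqxx; congr vol_integral.
by apply/funext => x; rewrite mulr1.
Qed.

Lemma sum_face_indicator (c : elt T -> 'I_n.+2 -> R) (v : vfield T) K :
  \sum_K' \sum_j surf_integral (face_vtx K' j)
    (fun x => c K' j * normal_comp v K' j x * elt_indicator K K') =
  \sum_j surf_integral (face_vtx K j) (fun x => c K j * normal_comp v K j x).
Proof.
rewrite (bigD1 K)//= [X in _ + X]big1 => [|K' K'K]; last first.
  rewrite big1// => j _; apply: surf_integral0 => x.
  by rewrite /elt_indicator (negPf K'K) mulr0.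
rewrite addr0; apply: eq_bigr => j _; congr surf_integral.
by apply/funext => x; rewrite /elt_indicator eqxx mulr1.
Qed.

Lemma frac_bounds Om phi_lo phi_hi lam_hi lamt_hi al s :
  admissible P Om phi_lo phi_hi lam_hi lamt_hi -> 0 <= s <= 1 ->
  0 <= Defs.frac P al s <= 1.
Proof.
move=> adm s01; have /andP[t0 _] := total_mobility_bounds adm s01.
have /andP[w0 _] := mobility_bounds adm wet s01.
have /andP[n0 _] := mobility_bounds adm nonwet s01.
rewrite /Defs.frac ler_pdivrMr// mul1r.
have al0 : 0 <= mobility P al s by case: al.
rewrite divr_ge0 ?(ltW t0)//=.
by case: al {al0}; rewrite ?lerDl ?lerDr.
Qed.

Section upwind_bounds.
Variables (S : phase -> elt T -> R) (ut xi : vfield T).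
Hypothesis S01 : forall al K, 0 < S al K < 1.

(** Upwind values come from the saturations of the adjacent elements, and inflow
    values from the projection of the boundary saturation. *)
Lemma face_sat_w_bounds al K j : (forall x, 0 <= sat_B P x <= 1) ->
  area_factor (face_vtx K j) != 0 -> 0 <= face_sat_w P S ut xi al K j <= 1.
Proof.
move=> B01 a0.
have S01w al' K' : 0 <= S al' K' <= 1.
  by have /andP[? ?] := S01 al' K'; rewrite !ltW.
have up al' K' : 0 <= upwind_interior P S ut xi al' K j K' <= 1.
  rewrite /upwind_interior /upwind_from.
  by case: ifP => _; case: ifP => _; exact: S01w.
rewrite /face_sat_w; case: neighbour => [K'|].
  case: al; first exact: up.
  by have /andP[? ?] := up nonwet K'; apply/andP; split; lra.
by case: ifP => _; [exact: L2_projection_const_bounds | exact: S01w].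
Qed.

End upwind_bounds.

Lemma sum_flux_le (v : vfield T) K (c : 'I_n.+2 -> R) : RT0 v ->
  (forall j, area_factor (face_vtx K j) != 0 -> 0 <= c j <= 1) ->
  `|\sum_j surf_integral (face_vtx K j) (fun x => c j * normal_comp v K j x)|
  <= (\sum_j face_area K j) * Linf_norm v.
Proof.
move=> vRT c01; apply: le_trans (ler_norm_sum _ _ _) _.
by rewrite mulr_suml; apply: ler_sum => j _; apply: flux_le => // /c01.
Qed.

Variables (Om : set point) (phi_lo phi_hi lamt_hi b1 b2 kappa : R).
Variables (lam_hi : phase -> R).
Hypotheses (phi_lo_gt0 : 0 < phi_lo) (b2_gt0 : 0 < b2).
Variables (t0 t1 : R) (S0 S1 p1 : phase -> elt T -> R).
Variables (ut0 xi0 ut1 xi1 : vfield T).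
Hypothesis adm : admissible P Om phi_lo phi_hi lam_hi lamt_hi.
Hypothesis OmE : mesh_of T Om.
Hypothesis qu : quasi_uniform T kappa.
Hypothesis A2 : assumption_A2 P S0 b1 b2.
Hypothesis t01 : t0 < t1.
Hypothesis S01 : forall al K, 0 < S0 al K < 1.
Hypothesis step : pimpes_step P t0 t1 S0 ut0 xi0 S1 p1 ut1 xi1.

(** The sum constraint, tested with the indicator of [K]. *)
Lemma sat_sum1 K : S1 nonwet K + S1 wet K = 1.
Proof.
have := step_saturation_sum step (elt_indicator K).
have cstE c : vol_integral (open_simplex (vtx K)) (fun=> c) =
    c * volume (open_simplex (vtx K)).
  exact: (Rintegral_cst _ (measurable_open_simplex (vtx_nondegenerate K))).
rewrite !inner_indicator !cstE.
by move/(mulIf (lt0r_neq0 (volume_elt_gt0 K qu))).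
Qed.

(** Mass balance of phase [al] in [K], obtained by testing the saturation equation
    with the indicator of [K].  To empty the element, all of the mass present,
    at least [phi_lo * S0 al K * |K|], has to leave it during the step.  The
    fractional flows being between 0 and 1, the outflow rate is at most the boundary
    area times the velocities; the sink removes at most [b2 * S0 al K <= b2] per
    unit volume. *)
Lemma mass_loss_le al K (L := Linf_norm ut1 + Linf_norm xi1) : S1 al K <= 0 ->
  phi_lo * S0 al K * volume (open_simplex (vtx K)) <=
  (t1 - t0) * (b2 * volume (open_simplex (vtx K)) + (\sum_j face_area K j) * L).
Proof.
move=> S1le0.
have mK := measurable_open_simplex (vtx_nondegenerate K).
have fK := open_simplex_fin (vtx_nondegenerate K).
have KOm := open_simplex_sub_domain (K := K) OmE.
have dt : 0 < t1 - t0 by rewrite subr_gt0.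
have c01 al' j : area_factor (face_vtx K j) != 0 ->
    0 <= Defs.frac P al' (face_sat_w P S0 ut0 xi0 al' K j) <= 1.
  move=> a0; apply: (frac_bounds _ adm); apply: face_sat_w_bounds => //.
  exact: sat_B_bounds adm.
have := step_saturation step al (elt_indicator K).
rewrite /B_phase /B_cap !inner_indicator !sum_face_indicator.
set V := volume _; set W := \sum_j face_area K j.
set flux := \sum_j surf_integral _ _; set cap := \sum_j surf_integral _ _.
have fluxW : `|flux| <= W * Linf_norm ut1 := sum_flux_le (step_ut step) (c01 al).
have capW : `|cap| <= W * Linf_norm xi1.
  apply: sum_flux_le (step_xi step) _ => j a0.
  have /andP[w0 w1] := c01 wet j a0; have /andP[n0 n1] := c01 nonwet j a0.
  by rewrite mulr_ge0//= mulr_ile1.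
have signW : - (W * Linf_norm xi1) <= phase_sign R al * cap.
  move: capW; rewrite ler_norml => /andP[? ?].
  by rewrite /phase_sign; case: (al); lra.
have srcV : - b2 * V <=
    vol_integral (open_simplex (vtx K)) (fun x => source P al x).
  apply: ge_npcst_Rintegral => //; first by rewrite oppr_le0 ltW.
  move=> t tK; have [F0|F0] := leP 0 (source P al (row_of_tuple t)).
    by apply: le_trans F0; rewrite oppr_le0 ltW.
  have /andP[_] := A2 tK F0; rewrite ltr0_norm// => Fb.
  rewrite lerNl; apply: le_trans Fb _; rewrite ler_piMr ?(ltW b2_gt0)//.
  by have /andP[_ /ltW] := S01 al K.
(* The density [phi * (S0 - S1) / dt] is nonnegative, and bounded because [phi]
   is, so its integral is bounded below by that of a constant. *)
have accV : phi_lo * (S0 al K / (t1 - t0)) * V <=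
    - vol_integral (open_simplex (vtx K))
        (fun x => porosity P x * ((S1 al K - S0 al K) / (t1 - t0))).
  rewrite /vol_integral -RintegralN_nomeas.
  have c0 : S0 al K / (t1 - t0) <= (S0 al K - S1 al K) / (t1 - t0).
    by rewrite ler_pM2r ?invr_gt0//; lra.
  have S00 : 0 <= S0 al K / (t1 - t0).
    by rewrite divr_ge0 ?(ltW dt)//; have /andP[/ltW] := S01 al K.
  apply: (@ge_nncst_Rintegral _ _ _ _ _ mK fK _ _
    (phi_hi * ((S0 al K - S1 al K) / (t1 - t0)))).
    by rewrite mulr_ge0// ltW.
  move=> t /KOm /(porosity_bounds adm) /andP[plo phi].
  rewrite -mulrN -mulNr opprB; apply/andP; split; last first.
    by rewrite ler_wpM2r// (le_trans S00).
  by apply: ler_pM => //; exact: ltW.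
move=> balance.
have fluxW' : flux <= W * Linf_norm ut1 by apply: le_trans (ler_norm _) fluxW.
have : phi_lo * (S0 al K / (t1 - t0)) * V <= b2 * V + W * L.
  by rewrite /L mulrDr; lra.
rewrite -(ler_pM2l dt); apply: le_trans.
rewrite le_eqVlt; apply/orP; left; apply/eqP.
by field; rewrite gt_eqF.
Qed.

End one_element.

(** * Preservation of the bounds *)

Theorem lemma4p3 (R : realType) (n : nat) (dim23 : n.+1 = 2%N \/ n.+1 = 3%N)
  (Om : set 'rV[R]_n.+1)
  (phi_lo phi_hi lamt_hi b1 b2 kappa : R) (lam_hi gam S_tol : phase -> R)
  (phi_lo_gt0 : 0 < phi_lo)
  (lam_hi_gt0 : forall al, 0 < lam_hi al) (lamt_hi_gt0 : 0 < lamt_hi)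
  (gam_gt0 : forall al, 0 < gam al) (b1_gt0 : 0 < b1) (b2_gt0 : 0 < b2)
  (S_tol_gt0 : forall al, 0 < S_tol al) :
  exists eps : R -> R -> R, (forall a b, 0 < eps a b) /\
  forall (P : two_phase R n.+1) (T : mesh R n)
    (t0 t1 : R) (S0 S1 p1 : phase -> elt T -> R) (ut0 xi0 ut1 xi1 : vfield T),
    admissible P Om phi_lo phi_hi lam_hi lamt_hi ->
    mesh_of T Om -> quasi_uniform T kappa ->
    assumption_A1 P gam ->
    assumption_A2 P S0 b1 b2 ->
    t0 < t1 ->
    (forall K, S0 nonwet K = 1 - S0 wet K) ->
    (forall al K, 0 < S0 al K < 1) ->
    (forall al K, S_tol al <= S0 al K) ->
    RT0 ut0 -> RT0 xi0 ->
    pimpes_step P t0 t1 S0 ut0 xi0 S1 p1 ut1 xi1 ->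
    forall K : elt T,
      (t1 - t0) / mesh_size T < eps (Linf_norm ut1) (Linf_norm xi1) ->
      forall al, 0 < S1 al K < 1.
Proof.
(* [C] bounds [h |boundary of K| / |K|] and [H] bounds the mesh size [h].  The
   absolute values make [eps] positive for all values of the parameters. *)
pose C : R := n.+2%:R * (Num.sqrt n`!%:R * volume (@reference_simplex R n)) *
  (4 * `|kappa| * n.+1%:R) ^+ n.+1.
pose H : R := 2 * `|diameter Om|.
pose St := Num.min (S_tol wet) (S_tol nonwet).
have C0 : 0 <= C.
  rewrite /C !mulr_ge0 ?exprn_ge0 ?sqrtr_ge0 ?mulr_ge0//.
  exact/ltW/volume_reference_simplex_gt0.
have H0 : 0 <= H by rewrite mulr_ge0.
have St0 : 0 < St by rewrite lt_min !S_tol_gt0.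
pose rate (a b : R) : R := b2 * H + C * (`|a| + `|b|).
have rate0 a b : 0 <= rate a b.
  by rewrite /rate addr_ge0// mulr_ge0 ?addr_ge0 ?(ltW b2_gt0).
exists (fun a b => phi_lo * St / (1 + rate a b)); split=> [a b|].
  by rewrite divr_gt0 ?mulr_gt0// ltr_pwDl.
move=> P T t0 t1 S0 S1 p1 ut0 xi0 ut1 xi1 adm OmE qu A1 A2 t01 S0c S01 S0t
  RTu RTx step K small al.
suff pos al' : 0 < S1 al' K.
  have s1 := sat_sum1 qu step K; have w := pos wet; have nw := pos nonwet.
  by case: al; apply/andP; split=> //; lra.
rewrite ltNge; apply/negP => S1le0.
(* [phi_lo * St <= ((t1 - t0) / h) * rate] would follow, contradicting the choice
   of [eps]. *)
have := mass_loss_le phi_lo_gt0 b2_gt0 adm OmE A2 t01 S01 step S1le0.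
set V := volume _; set W := \sum_j face_area K j; set L := Linf_norm ut1 + _.
have V0 : 0 < V := volume_elt_gt0 K qu.
have h0 := mesh_size_gt0 K; have hD := mesh_size_le K.
have [k0 _] := quasi_uniform_ball K qu.
have LE : L = `|Linf_norm ut1| + `|Linf_norm xi1|.
  rewrite (ger0_norm (Linf_norm_ge0 K (step_ut step))).
  by rewrite (ger0_norm (Linf_norm_ge0 K (step_xi step))).
have L0 : 0 <= L by rewrite LE addr_ge0.
have hW : mesh_size T * W <= C * V.
  apply: (@le_trans _ _ (elt_diam K * W)).
    rewrite ler_wpM2r// sumr_ge0// => j _.
    rewrite mulr_ge0 ?sqrtr_ge0// ltW//; exact: volume_reference_simplex_gt0.
  by rewrite /C ger0_norm ?(ltW k0)//; exact: sum_face_area_le.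
have hH : mesh_size T <= H.
  apply: le_trans hD _; apply: le_trans (elt_diam_le_domain K OmE) _.
  by rewrite ler_pM2l// ler_norm.
move: small; set e := (t1 - t0) / _; set r := rate _ _ => small.
have e0 : 0 < e by rewrite divr_gt0 ?subr_gt0.
have -> : t1 - t0 = e * mesh_size T by rewrite divfK ?gt_eqF.
apply/negP; rewrite -ltNge.
have StS : St <= S0 al' K.
  by apply: le_trans (S0t al' K); rewrite /St ge_min; case: (al'); rewrite lexx ?orbT.
apply: (@le_lt_trans _ _ (e * (r * V))).
  rewrite -mulrA ler_pM2l// mulrDr /r /rate mulrDl -LE; apply: lerD.
    by rewrite mulrCA -mulrA ler_pM2l// ler_pM2r.
  by rewrite mulrA [leRHS]mulrAC ler_wpM2r.
apply: (@lt_le_trans _ _ (phi_lo * St * V)); last first.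
  by rewrite ler_pM2r// ler_pM2l.
rewrite mulrA ltr_pM2r//; apply: (@le_lt_trans _ _ (e * (1 + r))).
  by rewrite ler_pM2l// lerDr.
by rewrite -ltr_pdivlMr// ltr_pwDl//; exact: rate0.
Qed.
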